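(* Let $q\in\mathbb{C}$ with $q\neq1$ be such that $[n]_q\neq 0$ for all $n\geq 1$, let $u,\alpha\in\mathbb{C}$, let $(a_n^{(\alpha)})_{n\ge0}$ be complex numbers with $a_0^{(\alpha)}\neq0$, $(\mathcal{A}_q(t))^{\alpha}=\sum_{n\ge0}a_n^{(\alpha)}\frac{t^n}{[n]_q!}$, and define $\mathrm{P}_{n,q}^{(\alpha)}(x,y;u)$ by $(\mathcal{A}_q(t))^{\alpha}\mathrm{e}_q(tx)\mathrm{e}_q(ty,u)=\sum_{n\ge0}\mathrm{P}_{n,q}^{(\alpha)}(x,y;u)\frac{t^n}{[n]_q!}$. Then for all integers $0\le k\le n$, $$D_{q,x}^{k}\mathrm{P}_{n,q}^{(\alpha)}(x,y;u)=\frac{[n]_q!}{[n-k]_q!}\mathrm{P}_{n-k,q}^{(\alpha)}(x,y;u),\qquad D_{q,y}^{k}\mathrm{P}_{n,q}^{(\alpha)}(x,y;u)=\frac{[n]_q!}{[n-k]_q!}u^{\binom{k}{2}}\mathrm{P}_{n-k,q}^{(\alpha)}(x,u^ky;u).$$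
   Context: $[n]_q=\frac{1-q^n}{1-q}$, $[n]_q!=[1]_q\cdots[n]_q$ ($[0]_q!=1$). $\mathrm{e}_q(z,u)=\sum_{n\ge0}u^{\binom{n}{2}}\frac{z^n}{[n]_q!}$ (convention $0^0=1$), $\mathrm{e}_q(z)=\mathrm{e}_q(z,1)$. $D_qf(x)=\frac{f(x)-f(qx)}{(1-q)x}$; $D_{q,x}$, $D_{q,y}$ act on the variable $x$, resp. $y$; $D^k$ denotes $k$-fold iteration ($D^0$ the identity). *)

(* Defs.v *)
(* Stated over a field F; the complex numbers are R[i] with R : realType. *)
From HB Require Import structures.
From mathcomp Require Import all_boot all_order all_algebra.
From mathcomp Require Import polyXY complex reals.

Set Implicit Arguments.
Unset Strict Implicit.
Unset Printing Implicit Defensive.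
Import GRing.Theory.
Local Open Scope ring_scope.

Section QNumbers.
Variable F : fieldType.
Implicit Types (q : F) (n : nat).

Definition qnum q n : F := (1 - q ^+ n) / (1 - q).

Definition qfact q n : F := \prod_(1 <= i < n.+1) qnum q i.

End QNumbers.

(* A formal power series in t over S is its coefficient sequence nat -> S. *)
Definition fps_mul (S : nzRingType) (f g : nat -> S) : nat -> S :=
  fun n => \sum_(i < n.+1) f i * g (n - i)%N.

Section Bivariate.
Variable F : fieldType.
Implicit Types (q u c : F) (n : nat).

(* F[x, y] is {poly {poly F}}: x is the outer variable 'X, y the inner one 'Y. *)
Definition cstXY c : {poly {poly F}} := c%:P%:P.

(* The series \sum_n (f n) t^n / [n]_q!. *)
Definition qegf q (f : nat -> {poly {poly F}}) : nat -> {poly {poly F}} :=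
  fun n => cstXY (qfact q n)^-1 * f n.

(* The series e_q(t z, u) in t. *)
Definition qexp q (z : {poly {poly F}}) u : nat -> {poly {poly F}} :=
  qegf q (fun n => cstXY (u ^+ 'C(n, 2)) * z ^+ n).

(* p(x, c y) *)
Definition dilateY c (p : {poly {poly F}}) : {poly {poly F}} :=
  map_poly (fun r => r \Po (c *: 'X)) p.

End Bivariate.

(* For q <> 1 the quotient is exact, so that D_q is also defined at 0 (and can
   be iterated even when q = 0); cf. qderivK and horner_qderX, horner_qderY. *)
Definition qderiv (S : idomainType) (q : S) (p : {poly S}) : {poly S} :=
  (p - (p \Po (q *: 'X))) %/ ((1 - q) *: 'X).

Definition qderX (F : fieldType) (q : F) (p : {poly {poly F}}) :=
  qderiv q%:P p.

Definition qderY (F : fieldType) (q : F) (p : {poly {poly F}}) :=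
  swapXY (qderX q (swapXY p)).

Lemma qderivK (S : idomainType) (q : S) (p : {poly S}) :
  1 - q \is a GRing.unit ->
  qderiv q p * ((1 - q) *: 'X) = p - (p \Po (q *: 'X)).
Proof.
move=> Uq; apply: Pdiv.IdomainUnit.divpK.
  by rewrite lead_coefZ lead_coefX mulr1.
rewrite dvdpZl; last by apply: contraTneq Uq => ->; rewrite unitr0.
have -> : 'X = 'X - 0%:P :> {poly S} by rewrite subr0.
rewrite dvdp_XsubCl rootE.
by rewrite !(hornerE, horner_comp) oppr0 mulr0 subrr.
Qed.

Lemma horner_qderX (F : fieldType) (q x y : F) (p : {poly {poly F}}) :
  q != 1 -> x != 0 ->
  (qderX q p).[x, y] = (p.[x, y] - p.[q * x, y]) / ((1 - q) * x).
Proof.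
move=> q1 x0; have q1' : 1 - q != 0 by rewrite subr_eq0 eq_sym.
apply/(canRL (mulfK _)); first by rewrite mulf_neq0.
have U : 1 - q%:P \is a @GRing.unit {poly F}.
  by rewrite -polyC1 -polyCB poly_unitE size_polyC q1' coefC unitfE.
have /(congr1 (fun r : {poly {poly F}} => r.[x, y])) := qderivK p U.
by rewrite -/(qderX q p) !(hornerE, horner_comp) /= polyCM.
Qed.

Lemma horner_qderY (F : fieldType) (q x y : F) (p : {poly {poly F}}) :
  q != 1 -> y != 0 ->
  (qderY q p).[x, y] = (p.[x, y] - p.[x, q * y]) / ((1 - q) * y).
Proof.
by move=> q1 y0; rewrite /qderY horner2_swapXY horner_qderX // !horner2_swapXY.
Qed.

Lemma horner_dilateY (F : fieldType) (c x y : F) (p : {poly {poly F}}) :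
  (dilateY c p).[x, y] = p.[x, c * y].
Proof.
rewrite /dilateY -{1}(comp_polyC x (c *: 'X)).
rewrite (horner_map (comp_poly (c *: 'X))) /= horner_comp.
by rewrite !hornerE.
Qed.

(* Main.v *)
Require Import Defs.
From HB Require Import structures.
From mathcomp Require Import all_boot all_order all_algebra.
From mathcomp Require Import polyXY complex reals.

Set Implicit Arguments.
Unset Strict Implicit.
Unset Printing Implicit Defensive.
Import GRing.Theory.
Local Open Scope ring_scope.

(* The operator D_{q,x} maps e_q(tx) to t e_q(tx) and is linear over series in
   y, while D_{q,y} maps e_q(ty, u) to t e_q(tuy, u) and is linear over series
   in x. Comparing coefficients of t^(n+1) gives the case k = 1; since
   D_{q,y}(p(x, cy)) = c (D_{q,y} p)(x, cy), iterating it produces the factor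
   u^(0 + 1 + ... + (k - 1)). *)

(** * Cauchy products under an additive operator *)

Section FormalSeries.
Variable S : comNzRingType.
Implicit Types (f g h : nat -> S) (n : nat).

Lemma fps_mulC f g : fps_mul f g =1 fps_mul g f.
Proof.
move=> n; rewrite /fps_mul (reindex_inj rev_ord_inj) /=.
by apply: eq_bigr => i _; rewrite subSS subKn -1?ltnS // mulrC.
Qed.

Variable D : {additive S -> S}.

Lemma additive_fps_mulr f g n :
  (forall i, {morph D : p / f i * p}) ->
  D (fps_mul f g n) = fps_mul f (D \o g) n.
Proof. by move=> Df; rewrite raddf_sum; apply: eq_bigr => i _; apply: Df. Qed.

(** This reduces the product of three series to a product of two: a pair of factors that are
    constants for [D] counts as a single one. *)
Lemma additive_morph_fps_mul f g :
    (forall i, {morph D : p / f i * p}) ->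
    (forall i, {morph D : p / g i * p}) ->
  forall n, {morph D : p / fps_mul f g n * p}.
Proof.
move=> Df Dg n p; rewrite !mulr_suml raddf_sum; apply: eq_bigr => i _.
by rewrite -!mulrA Df Dg.
Qed.

(** Coefficient form of: if D g(t) = t h(t) and [D] is linear over f, then D (f g)(t) = t (f h)(t).
    The top term of the sum pairs f with [g 0], which [D] kills; in the others the index of g drops
    by one. *)
Lemma additive_fps_mul_shift f g h n :
    (forall i, {morph D : p / f i * p}) ->
    D (g 0%N) = 0 -> (forall m, D (g m.+1) = h m) ->
  D (fps_mul f g n.+1) = fps_mul f h n.
Proof.
move=> Df Dg0 DgS; rewrite additive_fps_mulr // /fps_mul big_ord_recr /=.
rewrite subnn Dg0 mulr0 addr0; apply: eq_bigr => i _.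
by rewrite subSn ?DgS // -ltnS.
Qed.

End FormalSeries.

(** * Coefficients of q-derivatives and dilations *)

Lemma coef_comp_poly_scaleX (S : comNzRingType) (c : S) (p : {poly S}) n :
  (p \Po (c *: 'X))`_n = c ^+ n * p`_n.
Proof.
rewrite comp_polyE.
under eq_bigr do rewrite exprZn scalerA.
rewrite -(poly_def _ (fun i => p`_i * c ^+ i)) coef_poly mulrC.
by case: ltnP => // /(nth_default 0) ->; rewrite mulr0.
Qed.

Section QCalculus.
Variable F : fieldType.
Implicit Types (q u c : F) (p : {poly {poly F}}) (n : nat).

Lemma coef_cstXYM c p i j : (cstXY c * p)`_i`_j = c * p`_i`_j.
Proof. by rewrite !coefCM. Qed.

Lemma cstXYM c d : cstXY (c * d) = cstXY c * cstXY d.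
Proof. by rewrite /cstXY !polyCM. Qed.

Lemma coef_dilateY c p i j : (dilateY c p)`_i`_j = c ^+ j * p`_i`_j.
Proof. by rewrite coef_map /= coef_comp_poly_scaleX. Qed.

(* For q = 1 both sides are 0, since x / 0 = 0 and p %/ 0 = 0. *)
Lemma coef_qderX q p i : (qderX q p)`_i = (qnum q i.+1)%:P * p`_i.+1.
Proof.
have [->|q1] := eqVneq q 1.
  rewrite /qnum subrr invr0 mulr0 mul0r /qderX /qderiv.
  by rewrite subrr scale0r divp0 coef0.
have q1' : 1 - q != 0 by rewrite subr_eq0 eq_sym.
have Uq : 1 - q%:P \is a @GRing.unit {poly F}.
  by rewrite -polyC1 -polyCB poly_unitE size_polyC q1' coefC unitfE.
(* The factor ['X] in [qderivK] shifts indices, so degree i + 1 there gives degree i of the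
   q-derivative, up to the unit 1 - q. *)
have /(congr1 (fun r : {poly {poly F}} => r`_i.+1)) := qderivK p Uq.
rewrite -/(qderX q p) -scalerAr coefZ coefMX coefB coef_comp_poly_scaleX /=.
move=> E; apply: (mulrI Uq); rewrite E mulrA -polyC1 -polyCB -polyCM.
by rewrite mulrCA mulfV // mulr1 polyCB polyC_exp mulrBl polyC1 mul1r.
Qed.

Lemma coef_qderY q p i j : (qderY q p)`_i`_j = qnum q j.+1 * p`_i`_j.+1.
Proof. by rewrite coef_swapXY coef_qderX coefCM coef_swapXY. Qed.

Lemma polyXYP p p' : (forall i j, p`_i`_j = p'`_i`_j) -> p = p'.
Proof. by move=> E; apply/polyP => i; apply/polyP => j. Qed.

(** Registering the three operators as additive makes the series lemmas applicable to them. *)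
Lemma qderX_is_zmod_morphism q : zmod_morphism (qderX q).
Proof.
by move=> p p'; apply/polyP => i; rewrite !(coefB, coef_qderX) mulrBr.
Qed.

HB.instance Definition _ q :=
  GRing.isZmodMorphism.Build {poly {poly F}} {poly {poly F}} (qderX q)
    (qderX_is_zmod_morphism q).

Lemma qderY_is_zmod_morphism q : zmod_morphism (qderY q).
Proof. by move=> p p'; rewrite /qderY !raddfB. Qed.

HB.instance Definition _ q :=
  GRing.isZmodMorphism.Build {poly {poly F}} {poly {poly F}} (qderY q)
    (qderY_is_zmod_morphism q).

Lemma dilateY_is_zmod_morphism c : zmod_morphism (dilateY c).
Proof. by move=> p p'; rewrite /dilateY raddfB. Qed.

HB.instance Definition _ c :=
  GRing.isZmodMorphism.Build {poly {poly F}} {poly {poly F}} (dilateY c)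
    (dilateY_is_zmod_morphism c).

Lemma qderX_polyCM q (r : {poly F}) : {morph qderX q : p / r%:P * p}.
Proof.
by move=> p; apply/polyP => i; rewrite !(coef_qderX, coefCM) mulrCA.
Qed.

Lemma qderY_cstXYM q c : {morph qderY q : p / cstXY c * p}.
Proof.
by move=> p; apply: polyXYP => i j; rewrite !(coef_qderY, coef_cstXYM) mulrCA.
Qed.

Lemma dilateY_cstXYM c d : {morph dilateY c : p / cstXY d * p}.
Proof.
by move=> p; apply: polyXYP => i j; rewrite !(coef_dilateY, coef_cstXYM) mulrCA.
Qed.

(** Multiplying by a power of x shifts only the outer index, while D_{q,y} acts on the inner one. *)
Lemma qderY_XnM q n : {morph qderY q : p / 'X^n * p}.
Proof.
move=> p; apply: polyXYP => i j; rewrite coef_qderY !coefXnM.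
by case: ifP => _; rewrite ?coef_qderY // !coef0 mulr0.
Qed.

Lemma dilateY_XnM c n : {morph dilateY c : p / 'X^n * p}.
Proof.
move=> p; apply: polyXYP => i j; rewrite coef_dilateY !coefXnM.
by case: ifP => _; rewrite ?coef_dilateY // coef0 mulr0.
Qed.

(** * Action on powers of x and y *)

Lemma qderX_Xn q n : qderX q 'X^(n.+1) = cstXY (qnum q n.+1) * 'X^n.
Proof.
apply/polyP => i; rewrite coef_qderX coefCM !coefXn eqSS.
by case: eqVneq => [->|]; rewrite ?mulr0.
Qed.

Lemma qderY_Yn q n : qderY q ('Y ^+ n.+1) = cstXY (qnum q n.+1) * 'Y ^+ n.
Proof.
rewrite /qderY rmorphXn /= swapXY_Y qderX_Xn rmorphM rmorphXn /=.
by rewrite swapXY_X swapXY_polyC map_polyC.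
Qed.

Lemma dilateY_Yn c n : dilateY c ('Y ^+ n) = cstXY (c ^+ n) * 'Y ^+ n.
Proof.
apply: polyXYP => i j; rewrite coef_dilateY coef_cstXYM -polyC_exp coefC.
case: ifP => _; last by rewrite coef0 !mulr0.
by rewrite coefXn; case: eqVneq => [->|]; rewrite ?mulr0.
Qed.

Lemma dilateY1 p : dilateY 1 p = p.
Proof. by apply: polyXYP => i j; rewrite coef_dilateY expr1n mul1r. Qed.

Lemma dilateY_comp c d p : dilateY c (dilateY d p) = dilateY (c * d) p.
Proof. by apply: polyXYP => i j; rewrite !coef_dilateY exprMn mulrA. Qed.

(** The coefficient of y^j comes from that of y^(j+1), which the dilation scales by c^(j+1) = c *
    c^j. *)
Lemma qderY_dilateY q c p :
  qderY q (dilateY c p) = cstXY c * dilateY c (qderY q p).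
Proof.
apply: polyXYP => i j.
rewrite !(coef_qderY, coef_cstXYM, coef_dilateY) exprS -mulrA.
by rewrite mulrCA; congr (_ * _); rewrite mulrCA.
Qed.

(** * q-factorials and q-exponentials *)

Lemma qfact0 q : qfact q 0 = 1.
Proof. by rewrite /qfact big_nil. Qed.

Lemma qfactS q n : qfact q n.+1 = qfact q n * qnum q n.+1.
Proof. by rewrite /qfact big_nat_recr. Qed.

Section Appell.
Variable q : F.
Hypothesis qnum_neq0 : forall n, (1 <= n)%N -> qnum q n != 0.

Lemma qfact_neq0 n : qfact q n != 0.
Proof.
elim: n => [|n IH]; first by rewrite qfact0 oner_eq0.
by rewrite qfactS mulf_neq0 ?qnum_neq0.
Qed.

Lemma qfactVS n : (qfact q n.+1)^-1 * qnum q n.+1 = (qfact q n)^-1.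
Proof. by rewrite qfactS invfM mulfVK ?qnum_neq0. Qed.

Lemma qexpE z u n :
  qexp q z u n = cstXY ((qfact q n)^-1 * u ^+ 'C(n, 2)) * z ^+ n.
Proof. by rewrite cstXYM -mulrA. Qed.

Lemma qderX_qexp0 u : qderX q (qexp q 'X u 0) = 0.
Proof.
by apply/polyP => i; rewrite qexpE coef_qderX expr0 mulr1 coefC coef0 mulr0.
Qed.

Lemma qderY_qexp0 u : qderY q (qexp q 'Y u 0) = 0.
Proof.
apply: polyXYP => i j; rewrite !coef0 qexpE expr0 mulr1 coef_qderY /cstXY coefC.
by case: ifP => _; rewrite ?coefC ?coef0 mulr0.
Qed.

Lemma qderX_qexpS n : qderX q (qexp q 'X 1 n.+1) = qexp q 'X 1 n.
Proof.
rewrite !qexpE qderX_polyCM qderX_Xn mulrA -cstXYM !expr1n !mulr1.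
by rewrite qfactVS.
Qed.

(** The exponents 'C(n+1, 2) and 'C(n, 2) differ by n, and u^n is the factor that y -> u y puts on
    y^n. *)
Lemma qderY_qexpS u n :
  qderY q (qexp q 'Y u n.+1) = dilateY u (qexp q 'Y u n).
Proof.
rewrite !qexpE qderY_cstXYM qderY_Yn dilateY_cstXYM dilateY_Yn !mulrA -!cstXYM.
by rewrite mulrAC qfactVS binS bin1 exprD mulrA.
Qed.

(** * The q-Appell polynomials *)

Variables (u : F) (b : nat -> F) (P : nat -> {poly {poly F}}).
Local Notation A := (qegf q (fun m => cstXY (b m))).
Local Notation AEx := (fps_mul A (qexp q 'X 1)).
Hypothesis P_def : fps_mul AEx (qexp q 'Y u) =1 qegf q P.

Lemma appellE n :
  P n = cstXY (qfact q n) * fps_mul AEx (qexp q 'Y u) n.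
Proof. by rewrite P_def /qegf mulrA -cstXYM mulfV ?qfact_neq0 // mul1r. Qed.

Lemma qegf_cstXY n : A n = cstXY ((qfact q n)^-1 * b n).
Proof. by rewrite cstXYM. Qed.

Lemma qderX_appell n : qderX q (P n.+1) = cstXY (qnum q n.+1) * P n.
Proof.
rewrite !appellE qderX_polyCM mulrA -cstXYM [_ * qfact q n]mulrC.
rewrite -qfactS; congr (_ * _).
(* The shift lemma wants the constant factor first; for D_{q,x} this is e_q(ty, u). It is applied
   again below to A and e_q(tx). *)
rewrite fps_mulC [RHS]fps_mulC.
have DA i : {morph qderX q : p / A i * p}.
  by move=> p; rewrite qegf_cstXY qderX_polyCM.
apply: (additive_fps_mul_shift (D := qderX q)) => [i p||m].
- by rewrite qexpE /= -mulrA qderX_polyCM -polyC_exp qderX_polyCM mulrA.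
- rewrite (additive_fps_mulr (D := qderX q)) // /fps_mul big_ord1 /=.
  by rewrite qderX_qexp0 mulr0.
- apply: (additive_fps_mul_shift (D := qderX q)) => //.
    exact: qderX_qexp0.
  exact: qderX_qexpS.
Qed.

Lemma qderY_appell n :
  qderY q (P n.+1) = cstXY (qnum q n.+1) * dilateY u (P n).
Proof.
rewrite !appellE qderY_cstXYM dilateY_cstXYM mulrA -cstXYM.
rewrite [_ * qfact q n]mulrC -qfactS.
congr (_ * _).
(* Stated for any [D] because both [dilateY u] and [qderY q] treat A(t) e_q(tx) as a constant. *)
have morphAE (D : {additive {poly {poly F}} -> {poly {poly F}}}) :
    (forall c, {morph D : p / cstXY c * p}) ->
    (forall m, {morph D : p / 'X^m * p}) ->
    forall i, {morph D : p / AEx i * p}.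
  move=> DC DX; apply: additive_morph_fps_mul => i p.
    by rewrite qegf_cstXY DC.
  by rewrite qexpE -!mulrA DC DX.
(* On the right the dilation moves onto e_q(ty, u), giving the series h of the shift lemma. *)
rewrite (additive_fps_mulr (D := dilateY u)); last first.
  by apply: morphAE; [apply: dilateY_cstXYM|apply: dilateY_XnM].
apply: (additive_fps_mul_shift (D := qderY q)); last exact: qderY_qexpS.
  by apply: morphAE; [apply: qderY_cstXYM|apply: qderY_XnM].
exact: qderY_qexp0.
Qed.

Lemma iter_qderX_appell n k : (k <= n)%N ->
  iter k (qderX q) (P n) = cstXY (qfact q n / qfact q (n - k)) * P (n - k)%N.
Proof.
elim: k => [_|k IH lt_kn]; first by rewrite subn0 divff ?qfact_neq0 // mul1r.
(* The one-step rule needs a successor index, so n - k is written as (n - (k + 1)) + 1. *)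
rewrite iterS IH 1?ltnW // -(subnSK lt_kn) qderX_polyCM qderX_appell.
by rewrite mulrA -cstXYM -mulrA qfactVS.
Qed.

Lemma iter_qderY_appell n k : (k <= n)%N ->
  iter k (qderY q) (P n)
  = cstXY (qfact q n / qfact q (n - k) * u ^+ 'C(k, 2))
    * dilateY (u ^+ k) (P (n - k)%N).
Proof.
elim: k => [_|k IH lt_kn].
  by rewrite subn0 divff ?qfact_neq0 // dilateY1 !mul1r.
(* Passing the dilation by u^k releases a factor u^k, which raises 'C(k, 2) to 'C(k+1, 2); the
   one-step rule then adds one more dilation by u. *)
rewrite iterS IH 1?ltnW // -(subnSK lt_kn) qderY_cstXYM qderY_dilateY.
rewrite qderY_appell dilateY_cstXYM dilateY_comp -exprSr !mulrA -!cstXYM.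
rewrite -(qfactVS (n - k.+1)) binS bin1 exprD; congr (cstXY _ * _).
move: (qnum q _) => z.
by rewrite -!mulrA; do 2!congr (_ * _); rewrite [RHS]mulrC -mulrA.
Qed.

End Appell.

End QCalculus.

Theorem theorem7 (R : realType) (q : R[i]) (q_neq1 : q != 1)
    (qnum_neq0 : forall n : nat, (1 <= n)%N -> qnum q n != 0)
    (u alpha : R[i]) (a : R[i] -> nat -> R[i]) (a0 : a alpha 0%N != 0)
    (P : nat -> {poly {poly R[i]}})
    (P_def : fps_mul (fps_mul (qegf q (fun n => cstXY (a alpha n)))
                              (qexp q 'X 1))
                     (qexp q 'Y u)
             =1 qegf q P) :
  forall n k : nat, (k <= n)%N ->
    iter k (qderX q) (P n)
      = cstXY (qfact q n / qfact q (n - k)) * P (n - k)%N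
    /\
    iter k (qderY q) (P n)
      = cstXY (qfact q n / qfact q (n - k) * u ^+ 'C(k, 2))
        * dilateY (u ^+ k) (P (n - k)%N).
Proof.
move=> n k le_kn; split; last exact: iter_qderY_appell P_def _ _ le_kn.
exact: iter_qderX_appell P_def _ _ le_kn.
Qed.
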